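(* Let $R$ be a ring. Then $$\max\{\mathrm{pd}_R(M): M\in\mathcal F_1\mathcal F(R)\}\leq \mathrm{l\text{-}gl\text{-}dim}(R)\leq 1+\max\{\mathrm{pd}_R(M): M\in\mathcal F_1\mathcal F(R)\}.$$
   Context: $R$ is an associative ring with unit and modules are unital. $\mathrm{l\text{-}gl\text{-}dim}(R)$ is the left global dimension of $R$ and $\mathrm{pd}_R$ denotes projective dimension. Here $\max$ is understood as the supremum, with value $+\infty$ allowed. $\mathcal F_1$ is the class of right $R$-modules of flat dimension at most $1$. A left $R$-module $M$ is $\mathcal F_1$-flat if $\mathrm{Tor}_1^R(H,M)=0$ for every $H\in\mathcal F_1$; the class of all $\mathcal F_1$-flat left modules is denoted $\mathcal F_1\mathcal F(R)$. *)

(* Defs.v *)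
From HB Require Import structures.
From mathcomp Require Import all_boot all_order all_algebra.
From mathcomp Require Import ring_quotient generic_quotient.
From mathcomp Require Import boolp classical_sets.
From mathcomp Require Import constructive_ereal.
From mathcomp Require Import freeg.

Set Implicit Arguments.
Unset Strict Implicit.
Unset Printing Implicit Defensive.

Import GRing.Theory.

Local Open Scope ring_scope.
Local Open Scope quotient_scope.

(* A right R-module is a left module over the converse ring: for [H] of this  *)
(* type, [(r : GRing.converse R) *: h] is the right action h.r.  [pzRingType] *)
(* allows the zero ring.                                                      *)
Notation rmodType R := (lmodType (GRing.converse R)).

Section TensorProduct.
Variables (R : pzRingType) (H : rmodType R).

Section Object.
Variable M : lmodType R.

Definition tgen (h : H) (m : M) : {freeg (H * M)%type / int} := << (h, m) >>.

(* The subgroup of the free abelian group on H x M by which one divides. *)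
Inductive tensor_rel : {freeg (H * M)%type / int} -> Prop :=
| tensor_rel0 : tensor_rel 0
| tensor_relB x y : tensor_rel x -> tensor_rel y -> tensor_rel (x - y)
| tensor_relDl h h' m : tensor_rel (tgen (h + h') m - (tgen h m + tgen h' m))
| tensor_relDr h m m' : tensor_rel (tgen h (m + m') - (tgen h m + tgen h m'))
| tensor_relZ h (r : R) m :
    tensor_rel (tgen ((r : GRing.converse R) *: h) m - tgen h (r *: m)).

Definition tensor_relb : {pred {freeg (H * M)%type / int}} :=
  fun x => `[< tensor_rel x >].

Lemma tensor_relb_zmod : zmod_closed tensor_relb.
Proof.
split=> [|x y]; rewrite ?unfold_in; first exact/asboolP/tensor_rel0.
by move=> /asboolP xr /asboolP yr; apply/asboolP/tensor_relB.
Qed.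

HB.instance Definition _ :=
  GRing.isZmodClosed.Build _ tensor_relb tensor_relb_zmod.

Definition tensor : zmodType := Quotient.quot tensor_relb.

Definition tens (h : H) (m : M) : tensor :=
  \pi_(Quotient.quot tensor_relb) (tgen h m).

Lemma tensor_eqP (x y : {freeg (H * M)%type / int}) :
  reflect (tensor_rel (x - y)) (x == y %[mod Quotient.quot tensor_relb]).
Proof. by rewrite -Quotient.idealrBE unfold_in; exact: asboolP. Qed.

End Object.

Section Map.
Variables (M N : lmodType R) (f : {linear M -> N}).

Definition tensor_premap (x : {freeg (H * M)%type / int}) :
    {freeg (H * N)%type / int} :=
  fglift (fun hm : H * M => tgen hm.1 (f hm.2)) x.

Lemma tensor_premapB x y :
  tensor_premap (x - y) = tensor_premap x - tensor_premap y.
Proof. exact: lift_is_additive. Qed.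

Lemma tensor_premapD x y :
  tensor_premap (x + y) = tensor_premap x + tensor_premap y.
Proof.
have z0 : tensor_premap 0 = 0 by rewrite -(subrr 0) tensor_premapB subrr.
have zN z : tensor_premap (- z) = - tensor_premap z.
  by rewrite -sub0r tensor_premapB z0 sub0r.
by rewrite -{1}[y]opprK tensor_premapB zN opprK.
Qed.

Lemma tensor_premap_gen h m : tensor_premap (tgen h m) = tgen h (f m).
Proof. by rewrite /tensor_premap liftU scale1r. Qed.

Lemma tensor_premap_rel x : tensor_rel x -> tensor_rel (tensor_premap x).
Proof.
elim=> {x} [|x y _ xr _ yr|h h' m|h m m'|h r m].
- by rewrite -(subrr 0) tensor_premapB subrr; exact: tensor_rel0.
- by rewrite tensor_premapB; exact: tensor_relB.
- rewrite tensor_premapB tensor_premapD !tensor_premap_gen.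
  exact: tensor_relDl.
- rewrite tensor_premapB tensor_premapD !tensor_premap_gen linearD.
  exact: tensor_relDr.
- by rewrite tensor_premapB !tensor_premap_gen linearZ; exact: tensor_relZ.
Qed.

(* The map H (x) f; [tensor_map_tens] below characterizes it, as the [tens]   *)
(* generate the tensor product.                                               *)
Definition tensor_map (x : tensor M) : tensor N :=
  \pi_(Quotient.quot (@tensor_relb N))
    (tensor_premap (repr (x : Quotient.quot (@tensor_relb M)))).

Lemma tensor_map_pi x :
  tensor_map (\pi_(Quotient.quot (@tensor_relb M)) x) =
  \pi_(Quotient.quot (@tensor_relb N)) (tensor_premap x).
Proof.
apply/eqP/tensor_eqP; rewrite -tensor_premapB; apply: tensor_premap_rel.
by apply/tensor_eqP; rewrite reprK.
Qed.

Lemma tensor_map_tens h m : tensor_map (tens h m) = tens h (f m).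
Proof. by rewrite tensor_map_pi tensor_premap_gen. Qed.

Lemma tensor_map_is_zmod_morphism : zmod_morphism tensor_map.
Proof.
move=> x y.
rewrite -[x](@reprK _ (Quotient.quot (@tensor_relb M))).
rewrite -[y](@reprK _ (Quotient.quot (@tensor_relb M))).
by rewrite -raddfB !tensor_map_pi tensor_premapB raddfB.
Qed.

HB.instance Definition _ :=
  GRing.isZmodMorphism.Build (tensor M) (tensor N) tensor_map
    tensor_map_is_zmod_morphism.

End Map.

End TensorProduct.

Arguments tensor_map {R} H {M N} f x.

Definition exact_pair (U V W : zmodType) (f : U -> V) (g : V -> W) : Prop :=
  forall v, g v = 0 <-> exists u, f u = v.

Definition surj (U V : Type) (f : U -> V) : Prop := forall v, exists u, f u = v.

Definition projective (S : pzRingType) (P : lmodType S) : Prop :=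
  forall (A B : lmodType S) (g : {linear A -> B}) (f : {linear P -> B}),
    surj g -> exists h : {linear P -> A}, forall x, g (h x) = f x.

Definition flat (R : pzRingType) (H : rmodType R) : Prop :=
  forall (M N : lmodType R) (f : {linear M -> N}),
    injective f -> injective (tensor_map H f).

(* ... -> X 2 -> X 1 -> X 0 -> M -> 0 *)
Record resolution (S : pzRingType) (M : lmodType S) := Resolution {
  res_obj :> nat -> lmodType S;
  res_d : forall n, {linear res_obj n.+1 -> res_obj n};
  res_aug : {linear res_obj 0 -> M};
  res_exact : forall n, exact_pair (res_d n.+1) (res_d n);
  res_exact_aug : exact_pair (res_d 0) res_aug;
  res_surj : surj res_aug
}.

Definition all_terms (S : pzRingType) (M : lmodType S)
    (C : lmodType S -> Prop) (X : resolution M) : Prop :=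
  forall n, C (X n).

Definition length_le (S : pzRingType) (M : lmodType S)
    (X : resolution M) (n : nat) : Prop :=
  forall i, (n < i)%N -> forall x : X i, x = 0.

(* The least length of a resolution of M by modules of the class C, +oo if    *)
(* there is no resolution of finite length.  The zero module gets 0.          *)
Definition res_dim (S : pzRingType) (C : lmodType S -> Prop)
    (M : lmodType S) : \bar int :=
  infimum +oo%E [set n%:Z%:E | n in
    [set n : nat | exists X : resolution M, all_terms C X /\ length_le X n]].

Definition proj_dim (S : pzRingType) (M : lmodType S) : \bar int :=
  res_dim (@projective S) M.

Definition flat_dim (R : pzRingType) (H : rmodType R) : \bar int :=
  res_dim (@flat R) H.

Definition sup_proj_dim (S : pzRingType) (C : lmodType S -> Prop) : \bar int :=
  supremum -oo%E [set x | exists2 M : lmodType S, C M & x = proj_dim M].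

Definition l_gl_dim (R : pzRingType) : \bar int :=
  sup_proj_dim (fun _ : lmodType R => True).

(* Tor_{n+1}(H, M) = 0: the complex H (x) X has zero homology in degree n+1   *)
(* for every projective resolution X of M (the homology does not depend on X  *)
(* up to isomorphism).                                                        *)
Definition TorS_eq0 (R : pzRingType) (n : nat) (H : rmodType R)
    (M : lmodType R) : Prop :=
  forall X : resolution M, all_terms (@projective R) X ->
    exact_pair (tensor_map H (res_d X n.+1)) (tensor_map H (res_d X n)).

Definition F1 (R : pzRingType) (H : rmodType R) : Prop :=
  (flat_dim H <= 1)%E.

Definition F1_flat (R : pzRingType) (M : lmodType R) : Prop :=
  forall H : rmodType R, F1 H -> TorS_eq0 0 H M.

(* Main.v *)
(* K := ker (P -> M), with P a free module covering M.  If H has a flat       *)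
(* resolution 0 -> F1 -> F0 -> H -> 0, then Tor_1(H, K) = Tor_2(H, M) = 0, so *)
(* every such K is F1-flat; splicing a projective resolution of K with P      *)
(* yields pd M <= 1 + pd K.                                                   *)

From HB Require Import structures.
From mathcomp Require Import all_boot all_order all_algebra.
From mathcomp Require Import generic_quotient.
From mathcomp Require Import boolp classical_sets functions.
From mathcomp Require Import constructive_ereal.
From mathcomp Require Import freeg.
Require Import Defs.

Set Implicit Arguments.
Unset Strict Implicit.
Unset Printing Implicit Defensive.

Import Order.TTheory GRing.Theory Num.Theory.

Local Open Scope ring_scope.
Local Open Scope quotient_scope.

(** The lower bound holds because F1-flat modules are among all modules. For the upper bound, cover
    a module [M] by a free module [P] with kernel [K]. Dimension shifting gives Tor_1(H, K) =
    Tor_2(H, M), which vanishes when [H] has flat dimension at most 1. Hence [K] is F1-flat, its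
    projective dimension is bounded by the supremum, and [splice_resolution] bounds that of [M] by
    one more. The vanishing, [submodule_free_F1_flat], is obtained by chasing an element through a
    double complex instead of using long exact sequences. The chase needs exactness of tensoring
    with a flat module ([flat_exact]), right exactness in the right-module variable
    ([tensor_mapl_exact]), both drawn from [tensor_ker], and the fact that tensoring with a free
    module keeps injections injective ([basis_tensor_inj]). *)

Lemma exists_additive (U V : zmodType) (f : U -> V) :
  zmod_morphism f -> exists g : {additive U -> V}, g =1 f.
Proof.
move=> fB.
pose m := GRing.isZmodMorphism.Build U V f fB.
pose g : {additive U -> V} := HB.pack f m.
by exists g.
Qed.

Lemma exists_linear (S : pzRingType) (U V : lmodType S) (f : U -> V) :
  linear f -> exists g : {linear U -> V}, g =1 f.
Proof.
move=> fL.
pose m := GRing.isLinear.Build S U V *:%R f fL.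
pose g : {linear U -> V} := HB.pack f m.
by exists g.
Qed.

(** * Tensor products: induction, universal property, kernels *)

Section Tensor.
Variables (R : pzRingType) (H : rmodType R) (M : lmodType R).

Lemma tensDl (h h' : H) (m : M) : tens (h + h') m = tens h m + tens h' m.
Proof.
by rewrite /tens -raddfD; apply/eqP/tensor_eqP; apply: tensor_relDl.
Qed.

Lemma tensDr (h : H) (m m' : M) : tens h (m + m') = tens h m + tens h m'.
Proof.
by rewrite /tens -raddfD; apply/eqP/tensor_eqP; apply: tensor_relDr.
Qed.

Lemma tensZ (h : H) (r : R) (m : M) :
  tens ((r : GRing.converse R) *: h) m = tens h (r *: m).
Proof. by apply/eqP/tensor_eqP; apply: tensor_relZ. Qed.

Lemma tens0r (h : H) : tens h (0 : M) = 0.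
Proof. by apply: (addrI (tens h 0)); rewrite -tensDr !addr0. Qed.

Lemma tens0l (m : M) : tens (0 : H) m = 0.
Proof. by apply: (addrI (tens 0 m)); rewrite -tensDl !addr0. Qed.

Lemma tensBr (h : H) (m m' : M) : tens h (m - m') = tens h m - tens h m'.
Proof. by apply: (addIr (tens h m')); rewrite -tensDr !subrK. Qed.

Lemma tensBl (h h' : H) (m : M) : tens (h - h') m = tens h m - tens h' m.
Proof. by apply: (addIr (tens h' m)); rewrite -tensDl !subrK. Qed.

Lemma freeg_int_ind (P : {freeg (H * M)%type / int} -> Prop) :
  P 0 -> (forall x y, P x -> P y -> P (x - y)) ->
  (forall h m, P (tgen h m)) -> forall x, P x.
Proof.
move=> P0 PB Pg x.
have PN y : P y -> P (- y) by move=> Py; rewrite -sub0r; apply: PB.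
have PD y z : P y -> P z -> P (y + z).
  by move=> Py Pz; rewrite -[z]opprK; apply: PB => //; apply: PN.
have Pn (n : nat) h m : P (tgen h m *+ n).
  by elim: n => [|n IHn]; rewrite ?mulr0n// mulrS; apply: PD.
have Pz (k : int) h m : P (<< k *g (h, m) >>).
  have -> : << k *g (h, m) >> = tgen h m *~ k by rewrite freegU_mulz intz.
  by case: k => n; [exact: Pn | rewrite NegzE mulrNz; apply/PN/Pn].
rewrite -(freeg_sumE x).
by elim/big_rec: _ => // -[h m] y _; apply: PD.
Qed.

Lemma tensor_ind (P : tensor H M -> Prop) :
  P 0 -> (forall x y, P x -> P y -> P (x - y)) ->
  (forall h m, P (tens h m)) -> forall x, P x.
Proof.
move=> P0 PB Pt x.
rewrite -[x](@reprK _ (Quotient.quot (@tensor_relb R H M))).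
elim/freeg_int_ind: (repr _) => [|y z Py Pz|h m].
- by rewrite raddf0.
- by rewrite raddfB; apply: PB.
- exact: Pt.
Qed.

Lemma freeg_lift (Z : zmodType) (b : H -> M -> Z) :
  exists g : {additive {freeg (H * M)%type / int} -> Z},
    forall h m, g (tgen h m) = b h m.
Proof.
(* [fglift] expects a module over the coefficients, so [Z] is viewed as a module over [int]. *)
pose f (hm : H * M) : zmodule Z := b hm.1 hm.2.
have [|g gE] := @exists_additive {freeg (H * M)%type / int} Z (fglift f).
  by move=> x y; exact: (@lift_is_additive _ _ (zmodule Z) f x y).
by exists g => h m; rewrite gE /tgen liftU scale1r.
Qed.

(** The universal property: the lift of [b] to the free group kills the relations, so its value does
    not depend on the representative. *)
Lemma tensor_lift (Z : zmodType) (b : H -> M -> Z) :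
  (forall h h' m, b (h + h') m = b h m + b h' m) ->
  (forall h m m', b h (m + m') = b h m + b h m') ->
  (forall h (r : R) m, b ((r : GRing.converse R) *: h) m = b h (r *: m)) ->
  exists phi : {additive tensor H M -> Z}, forall h m, phi (tens h m) = b h m.
Proof.
move=> bDl bDr bZ; have [g gE] := freeg_lift b.
have g_rel x : tensor_rel x -> g x = 0.
  elim=> {x} [|x y _ gx _ gy|h h' m|h m m'|h r m].
  - by rewrite raddf0.
  - by rewrite raddfB gx gy subrr.
  - by rewrite raddfB raddfD !gE bDl subrr.
  - by rewrite raddfB raddfD !gE bDr subrr.
  - by rewrite raddfB !gE bZ subrr.
pose phi (x : tensor H M) := g (repr (x : Quotient.quot (@tensor_relb R H M))).
have phi_pi x : phi (\pi_(Quotient.quot (@tensor_relb R H M)) x) = g x.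
  apply/eqP; rewrite -subr_eq0 /phi -raddfB; apply/eqP/g_rel.
  by apply/tensor_eqP; rewrite reprK.
have [x y|f fE] := @exists_additive _ _ phi; last first.
  by exists f => h m; rewrite fE phi_pi gE.
rewrite -[x](@reprK _ (Quotient.quot (@tensor_relb R H M))).
rewrite -[y](@reprK _ (Quotient.quot (@tensor_relb R H M))).
by rewrite -raddfB !phi_pi raddfB.
Qed.

End Tensor.

(* The sections [s] of [p] and [t] of [q] are mere functions, but             *)
(* [tens (s h) (t m)] is additive and balanced in (h, m) modulo [I], hence    *)
(* descends to an inverse of [phi] modulo [I].                                *)
Lemma tensor_ker (R : pzRingType) (H H' : rmodType R) (M M' : lmodType R)
    (p : {linear H -> H'}) (q : {linear M -> M'})
    (phi : {additive tensor H M -> tensor H' M'}) (I : tensor H M -> Prop) :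
  surj p -> surj q -> (forall h m, phi (tens h m) = tens (p h) (q m)) ->
  I 0 -> (forall x y, I x -> I y -> I (x - y)) ->
  (forall h m, p h = 0 -> I (tens h m)) ->
  (forall h m, q m = 0 -> I (tens h m)) ->
  forall x, phi x = 0 -> I x.
Proof.
move=> /choice[s sK] /choice[t tK] phiE I0 IB Ip Iq x.
have IN y : I y -> I (- y) by move=> Iy; rewrite -sub0r; apply: IB.
have ID y z : I y -> I z -> I (y + z).
  by move=> Iy Iz; rewrite -[z]opprK; apply: IB => //; apply: IN.
have congr_tens h h' m m' : p h = p h' -> q m = q m' ->
    I (tens h m - tens h' m').
  move=> ph qm.
  have -> : tens h m - tens h' m' = tens (h - h') m + tens h' (m - m').
    by rewrite tensBl tensBr addrA subrK.
  by apply: ID; [apply: Ip | apply: Iq]; rewrite linearB ?ph ?qm subrr.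
have [g gE] := freeg_lift (fun h m => tens (s h) (t m)).
have g_rel y : tensor_rel y -> I (g y).
  elim=> {y} [|y z _ Iy _ Iz|h h' m|h m m'|h r m].
  - by rewrite raddf0.
  - by rewrite raddfB; apply: IB.
  - by rewrite raddfB raddfD !gE -tensDl; apply: congr_tens;
      rewrite ?linearD ?sK.
  - by rewrite raddfB raddfD !gE -tensDr; apply: congr_tens;
      rewrite ?linearD ?tK.
  (* The sections need not commute with [r]; inserting the scalar by hand, moved across by [tensZ],
     leaves two differences covered by [congr_tens]. *)
  - rewrite raddfB !gE; have -> : tens (s ((r : GRing.converse R) *: h)) (t m) -
        tens (s h) (t (r *: m)) =
      tens (s ((r : GRing.converse R) *: h)) (t m) -
        tens ((r : GRing.converse R) *: s h) (t m) +
      (tens (s h) (r *: t m) - tens (s h) (t (r *: m))).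
      by rewrite tensZ addrA subrK.
    by apply: ID; apply: congr_tens; rewrite ?linearZ ?sK ?tK ?linearZ //= ?tK.
(* [k] lifts [phi] to the free groups. If [phi] kills the class of [x], then [k x] is a relation, so
   [g (k x)] lies in [I]; modulo [I] it is the class of [x]. *)
have [k kE] := freeg_lift (fun h m => tgen (p h) (q m)).
rewrite -[x](@reprK _ (Quotient.quot (@tensor_relb R H M))).
move: (repr _) => {}x phix.
have pi_k : phi (\pi x) = \pi_(Quotient.quot (@tensor_relb R H' M')) (k x).
  elim/freeg_int_ind: {phix} x => [|y z Ey Ez|h m]; first by rewrite !raddf0.
    by rewrite !raddfB Ey Ez.
  by rewrite kE phiE.
have Igk : I (g (k x) - \pi_(Quotient.quot (@tensor_relb R H M)) x).
  elim/freeg_int_ind: {phix pi_k} x => [|y z Iy Iz|h m].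
  - by rewrite !raddf0 addr0.
  - by rewrite !raddfB addrACA -opprD; apply: IB.
  - by rewrite kE gE; apply: congr_tens; rewrite ?sK ?tK.
have Ig : I (g (k x)).
  apply: g_rel; rewrite -[k x]subr0; apply/tensor_eqP.
  by rewrite -pi_k phix raddf0.
by rewrite -(subKr (g (k x)) (\pi x)); apply: IB.
Qed.

(** * Submodules as modules *)

Section Submodule.
Variables (S : pzRingType) (V : lmodType S) (P : V -> Prop).

Definition linear_stable : Prop :=
  P 0 /\ forall (a : S) u v, P u -> P v -> P (a *: u + v).

Hypothesis PL : linear_stable.

(** The stability proof is an argument so that the closure instance can be attached to the
    predicate. *)
Definition submodule_mem of linear_stable : {pred V} := fun v => `[< P v >].

Lemma submodule_mem_closed : submod_closed (submodule_mem PL).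
Proof.
split=> [|a u v]; rewrite !unfold_in; first exact/asboolP/(proj1 PL).
by move=> /asboolP Pu /asboolP Pv; apply/asboolP/(proj2 PL).
Qed.

HB.instance Definition _ :=
  GRing.isSubmodClosed.Build S V (submodule_mem PL) submodule_mem_closed.

Record submodule := Submodule {
  submodule_val : V; _ : submodule_val \in submodule_mem PL }.

HB.instance Definition _ := [isSub for submodule_val].
HB.instance Definition _ := [Choice of submodule by <:].
HB.instance Definition _ := [SubChoice_isSubLmodule of submodule by <:].

(** Serves for images, for finitely supported functions and for the kernel of a free cover. *)
Lemma exists_submodule : exists (W : lmodType S) (i : {linear W -> V}),
  injective i /\ forall v, P v <-> exists w, i w = v.
Proof.
exists submodule, (val : {linear submodule -> V}); split; first exact: val_inj.
move=> v; split=> [Pv|[w <-]]; last first.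
  by have := valP w; rewrite unfold_in => /asboolP.
have Pv' : v \in submodule_mem PL by rewrite unfold_in; apply/asboolP.
by exists (Submodule Pv').
Qed.

End Submodule.

(** * Functoriality and exactness of the tensor product *)

Lemma tensor_map_comp (R : pzRingType) (H : rmodType R) (A B C : lmodType R)
    (f : {linear A -> B}) (g : {linear B -> C}) x :
  tensor_map H g (tensor_map H f x) = tensor_map H (g \o f) x.
Proof.
elim/tensor_ind: x => [|x y fx fy|h a]; first by rewrite !raddf0.
  by rewrite !raddfB /= fx fy.
by rewrite !tensor_map_tens.
Qed.

(** The commuting squares of the double complex. *)
Lemma tensor_map_mapl (R : pzRingType) (H H' : rmodType R) (A B : lmodType R)
    (f : {linear A -> B}) (p : {linear H -> H'})
    (pA : {additive tensor H A -> tensor H' A})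
    (pB : {additive tensor H B -> tensor H' B}) :
  (forall h a, pA (tens h a) = tens (p h) a) ->
  (forall h b, pB (tens h b) = tens (p h) b) ->
  forall x, tensor_map H' f (pA x) = pB (tensor_map H f x).
Proof.
move=> pAE pBE; elim/tensor_ind => [|x y fx fy|h a]; first by rewrite !raddf0.
  by rewrite !raddfB /= fx fy.
by rewrite pAE !tensor_map_tens pBE.
Qed.

Lemma tensor_map0 (R : pzRingType) (H : rmodType R) (A B : lmodType R)
    (f : {linear A -> B}) :
  (forall a, f a = 0) -> forall x, tensor_map H f x = 0.
Proof.
move=> f0; elim/tensor_ind => [|x y fx fy|h a]; first by rewrite raddf0.
  by rewrite raddfB /= fx fy subrr.
by rewrite tensor_map_tens f0 tens0r.
Qed.

Section Exactness.
Variable R : pzRingType.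

(** Flatness speaks of injections only, so [g] is factored through its image [I]: tensoring the
    inclusion [i] stays injective, and the kernel of the tensored surjection [q] is handled by
    [tensor_ker]. *)
Lemma flat_exact (F : rmodType R) (A B C : lmodType R)
    (f : {linear A -> B}) (g : {linear B -> C}) :
  flat F -> exact_pair f g -> exact_pair (tensor_map F f) (tensor_map F g).
Proof.
move=> flatF fg y; split=> [gy|[x <-]]; last first.
  rewrite tensor_map_comp; apply: tensor_map0 => a.
  by apply/fg; exists a.
have [|I [i [i_inj iP]]] :=
    @exists_submodule R C (fun c => exists b, g b = c).
  split=> [|a _ _ [b <-] [b' <-]]; first by exists 0; rewrite raddf0.
  by exists (a *: b + b'); rewrite linearP.
have /choice[q0 q0K] b : exists c, i c = g b by apply/iP; exists b.
have [|q qE] := @exists_linear R B I q0.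
  by move=> a u v; apply: i_inj; rewrite linearP !q0K linearP.
have iq b : i (q b) = g b by rewrite qE q0K.
have iqT x : tensor_map F i (tensor_map F q x) = tensor_map F g x.
  elim/tensor_ind: x => [|x x' Ex Ex'|h b]; first by rewrite !raddf0.
    by rewrite !raddfB /= Ex Ex'.
  by rewrite !tensor_map_tens iq.
have qy : tensor_map F q y = 0.
  by apply: (flatF _ _ i i_inj); rewrite iqT gy raddf0.
move: qy; apply: (@tensor_ker _ _ _ _ _ idfun q _
    (fun y => exists x, tensor_map F f x = y)) => //.
- by move=> h; exists h.
- move=> c; have /iP[b gb] : exists w, i w = i c by exists c.
  by exists b; apply: i_inj; rewrite iq.
- by move=> h b; rewrite /= tensor_map_tens.
- by exists 0; rewrite raddf0.
- by move=> _ _ [x <-] [x' <-]; exists (x - x'); rewrite raddfB.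
- by move=> h m /= ->; exists 0; rewrite raddf0 tens0l.
- move=> h b qb; have /fg[a <-] : g b = 0 by rewrite -iq qb raddf0.
  by exists (tens h a); rewrite tensor_map_tens.
Qed.

Lemma exists_tensor_mapl (M : lmodType R) (H H' : rmodType R)
    (p : {linear H -> H'}) :
  exists phi : {additive tensor H M -> tensor H' M},
    forall h m, phi (tens h m) = tens (p h) m.
Proof.
apply: tensor_lift => [h h' m|h m m'|h r m].
- by rewrite linearD tensDl.
- by rewrite tensDr.
- by rewrite linearZ -tensZ.
Qed.

Lemma tensor_mapl_exact (M : lmodType R) (F1 F0 H : rmodType R)
    (i : {linear F1 -> F0}) (p : {linear F0 -> H})
    (phi : {additive tensor F1 M -> tensor F0 M})
    (psi : {additive tensor F0 M -> tensor H M}) :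
  (forall h m, phi (tens h m) = tens (i h) m) ->
  (forall h m, psi (tens h m) = tens (p h) m) ->
  surj p -> exact_pair i p -> forall x, psi x = 0 -> exists y, phi y = x.
Proof.
move=> phiE psiE psurj ip.
apply: (@tensor_ker _ _ _ _ _ p idfun) => //.
- by move=> m; exists m.
- by exists 0; rewrite raddf0.
- by move=> _ _ [x <-] [x' <-]; exists (x - x'); rewrite raddfB.
- by move=> h m /ip[h' <-]; exists (tens h' m).
- by move=> h m /= ->; exists 0; rewrite raddf0 tens0r.
Qed.

Lemma tensor_mapl_surj (M : lmodType R) (F0 H : rmodType R)
    (p : {linear F0 -> H}) (psi : {additive tensor F0 M -> tensor H M}) :
  (forall h m, psi (tens h m) = tens (p h) m) -> surj p -> surj psi.
Proof.
move=> psiE psurj; elim/tensor_ind => [|x y [x' <-] [y' <-]|h m].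
- by exists 0; rewrite raddf0.
- by exists (x' - y'); rewrite raddfB.
- by have [h' <-] := psurj h; exists (tens h' m).
Qed.

End Exactness.

(** * Free modules *)

(** Both sums reduce to the indices common to [s] and [s']. This frees the map built in [basis_lift]
    from the choice of a support. *)
Lemma eq_big_support (T : eqType) (V : zmodType) (s s' : seq T) (g : T -> V) :
  uniq s -> uniq s' -> (forall t, t \notin s -> g t = 0) ->
  (forall t, t \notin s' -> g t = 0) -> \sum_(t <- s) g t = \sum_(t <- s') g t.
Proof.
have restrict (u u' : seq T) : (forall t, t \notin u' -> g t = 0) ->
    \sum_(t <- u) g t = \sum_(t <- [seq t <- u | t \in u']) g t.
  move=> g0; rewrite big_filter [RHS]big_mkcond; apply: eq_bigr => t _.
  by case: ifPn => // /g0.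
move=> us us' gs gs'; rewrite (restrict s s')// (restrict s' s)//.
apply: perm_big; apply: uniq_perm; rewrite ?filter_uniq// => t.
by rewrite !mem_filter andbC.
Qed.

Section Basis.
Variables (S : pzRingType) (T : eqType).

(** Freeness on the basis [e], phrased by dual coordinates; the spanning property is recovered in
    [basis_expand]. *)
Definition basis_coord (P : lmodType S) (e : T -> P)
    (c : T -> {linear P -> S^o}) : Prop :=
  [/\ forall t u, c u (e t) = (u == t)%:R,
      forall x, exists s : seq T, forall t, t \notin s -> c t x = 0 &
      forall x, (forall t, c t x = 0) -> x = 0].

(** The finitely supported functions on [T], with indicator functions as basis and evaluations as
    coordinates. *)
Lemma exists_basis : exists P e c, @basis_coord P e c.
Proof.
have [|P [i [i_inj iP]]] := @exists_submodule S (T -> S^o)%type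
    (fun f => exists s : seq T, forall t, t \notin s -> f t = 0).
  split=> [|a f g [s fs] [s' gs']]; first by exists [::].
  exists (s ++ s') => t; rewrite mem_cat negb_or => /andP[ts ts'].
  by rewrite -[LHS]/(a *: f t + g t) fs// gs'// scaler0 addr0.
have /choice[e eE] t : exists x, i x = (fun u => (u == t)%:R).
  apply/iP; exists [:: t] => u; rewrite inE => /negPf ->//.
have /choice[c cE] t : exists c : {linear P -> S^o}, forall x, c x = i x t.
  apply: (@exists_linear S P S^o (fun x => i x t)) => a x y.
  by rewrite linearP.
exists P, e, c; split=> [t u|x|x x0].
- by rewrite cE eE.
- have /iP[s xs] : exists w, i w = i x by exists x.
  by exists s => t ts; rewrite cE xs.
- by apply: i_inj; rewrite raddf0; apply/funext => t; rewrite -cE x0.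
Qed.

Variables (P : lmodType S) (e : T -> P) (c : T -> {linear P -> S^o}).
Hypothesis Pec : basis_coord e c.

Lemma basis_expand x (s : seq T) :
  uniq s -> (forall t, t \notin s -> c t x = 0) ->
  x = \sum_(t <- s) (c t x : S) *: e t.
Proof.
have [ce _ c_inj] := Pec; move=> us xs.
apply/eqP; rewrite -subr_eq0; apply/eqP/c_inj => u.
rewrite raddfB raddf_sum /=.
under eq_bigr => t _ do rewrite linearZ /= ce.
have [us'|us'] := boolP (u \in s); last first.
  rewrite xs// big_seq big1 ?subrr// => t ts.
  by case: eqVneq => [ut|_]; [rewrite ut ts in us' | rewrite scaler0].
rewrite (bigD1_seq u)//= eqxx big1 => [|t /negPf tu].
  by rewrite addr0 -[_ *: _]/(_ * _) mulr1 subrr.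
by rewrite eq_sym tu scaler0.
Qed.

Lemma basis_lift (A : lmodType S) (a : T -> A) :
  exists h : {linear P -> A}, forall t, h (e t) = a t.
Proof.
have [ce c_fin _] := Pec.
have /choice[s sP] := c_fin.
pose h x := \sum_(t <- undup (s x)) (c t x : S) *: a t.
have hE x s' : uniq s' -> (forall t, t \notin s' -> c t x = 0) ->
    h x = \sum_(t <- s') (c t x : S) *: a t.
  move=> us' xs'; apply: eq_big_support; rewrite ?undup_uniq// => t.
    by rewrite mem_undup => /sP ->; rewrite scale0r.
  by move/xs' ->; rewrite scale0r.
have [|h' h'E] := @exists_linear S P A h.
  move=> k x y; pose s' := undup (s x ++ s y).
  have xs' t : t \notin s' -> c t x = 0 /\ c t y = 0.
    by rewrite mem_undup mem_cat negb_or => /andP[tx ty]; rewrite !sP.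
  have us' : uniq s' by exact: undup_uniq.
  rewrite (hE x s')// => [|t /xs'[]//]; rewrite (hE y s')// => [|t /xs'[]//].
  rewrite (hE _ s')// => [|t /xs'[tx ty]]; last first.
    by rewrite linearP tx ty scaler0 addr0.
  rewrite scaler_sumr -big_split /=; apply: eq_bigr => t _.
  by rewrite linearP /= scalerDl scalerA.
exists h' => t; rewrite h'E (hE _ [:: t])//.
  by rewrite big_seq1 ce eqxx scale1r.
by move=> u; rewrite inE ce => /negPf ->.
Qed.

Lemma basis_projective : projective P.
Proof.
move=> A B g f gsurj.
have /choice[a aE] t : exists y, g y = f (e t) by exact: gsurj.
have [h hE] := basis_lift a; exists h => x.
have [_ c_fin _] := Pec; have [s xs] := c_fin x.
rewrite (@basis_expand x (undup s)) ?undup_uniq//; last first.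
  by move=> t; rewrite mem_undup; apply: xs.
rewrite !raddf_sum; apply: eq_bigr => t _.
by rewrite /= !linearZ /= hE aE.
Qed.

End Basis.

Section BasisTensor.
Variables (R : pzRingType) (T : eqType) (P : lmodType R) (e : T -> P).
Variable c : T -> {linear P -> R^o}.
Hypothesis Pec : basis_coord e c.

Lemma basis_tensor_coord (F : rmodType R) :
  exists d : T -> {additive tensor F P -> F},
    forall t h x, d t (tens h x) = (c t x : GRing.converse R) *: h.
Proof.
have d_ex t : exists d : {additive tensor F P -> F},
    forall h x, d (tens h x) = (c t x : GRing.converse R) *: h.
  apply: tensor_lift => [h h' x|h x y|h r x].
  - by rewrite scalerDr.
  - by rewrite linearD scalerDl.
  - by rewrite scalerA linearZ.
by have [d dE] := choice d_ex; exists d.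
Qed.

(** The tensor product with [P] is a direct sum of copies of [F] indexed by [T], and [phi] acts as
    [i] on each coordinate [d t]. *)
Lemma basis_tensor_inj (F F' : rmodType R) (i : {linear F -> F'})
    (phi : {additive tensor F P -> tensor F' P}) :
  (forall h x, phi (tens h x) = tens (i h) x) ->
  injective i -> forall x, phi x = 0 -> x = 0.
Proof.
move=> phiE i_inj x phix.
have [d dE] := basis_tensor_coord F; have [d' d'E] := basis_tensor_coord F'.
have id y t : i (d t y) = d' t (phi y).
  elim/tensor_ind: y => [|y z Ey Ez|h m]; first by rewrite !raddf0.
    by rewrite !raddfB /= Ey Ez.
  by rewrite phiE dE d'E linearZ.
have dx t : d t x = 0 by apply: i_inj; rewrite id phix !raddf0.
(* The expansion is asked on every larger list, so that two elements can be expanded over a common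
   one. *)
suff [s xs] : exists s : seq T, forall s' : seq T,
    uniq s' -> {subset s <= s'} -> x = \sum_(t <- s') tens (d t x) (e t).
  rewrite (xs (undup s)) ?undup_uniq// => [|t]; last by rewrite mem_undup.
  by rewrite big1// => t _; rewrite dx tens0l.
elim/tensor_ind: {phix dx} x => [|x y [s xs] [s' ys']|h p].
- by exists [::] => s' _ _; rewrite big1// => t _; rewrite raddf0 tens0l.
- exists (s ++ s') => u uu su.
  rewrite {1}(xs u)// => [|t ts]; last by apply: su; rewrite mem_cat ts.
  rewrite {1}(ys' u)// => [|t ts]; last by apply: su; rewrite mem_cat ts orbT.
  rewrite -sumrB; apply: eq_bigr => t _.
  by rewrite raddfB tensBl.
- have [_ c_fin _] := Pec; have [s ps] := c_fin p.
  exists s => u uu su.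
  rewrite {1}(basis_expand Pec uu (x := p)); last first.
    by move=> t tu; apply: ps; apply: contra tu; apply: su.
  have tens_sum (r : seq T) (v : T -> P) :
      tens h (\sum_(t <- r) v t) = \sum_(t <- r) tens h (v t).
    elim: r => [|t r IHr]; first by rewrite !big_nil tens0r.
    by rewrite !big_cons tensDr IHr.
  by rewrite tens_sum; apply: eq_bigr => t _; rewrite dE tensZ.
Qed.

End BasisTensor.

(** * Dimensions as extended integers *)

Definition has_resolution_le (S : pzRingType) (C : lmodType S -> Prop)
    (M : lmodType S) (n : nat) : Prop :=
  exists X : resolution M, all_terms C X /\ length_le X n.

Lemma has_resolution_le_mono (S : pzRingType) (C : lmodType S -> Prop)
    (M : lmodType S) (m n : nat) :
  (m <= n)%N -> has_resolution_le C M m -> has_resolution_le C M n.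
Proof.
move=> mn [X [CX Xm]]; exists X; split=> // i ni.
by apply: Xm; exact: leq_ltn_trans ni.
Qed.

Section ResDim.
Variables (S : pzRingType) (C : lmodType S -> Prop) (M : lmodType S).

(** A nonempty set of lengths has a least element, which is then its infimum; the empty set yields
    the default [+oo]. *)
Lemma res_dim_cases :
  (res_dim C M = +oo%E /\ forall n, ~ has_resolution_le C M n) \/
  exists n, [/\ res_dim C M = n%:Z%:E, has_resolution_le C M n &
                forall k, has_resolution_le C M k -> (n <= k)%N].
Proof.
set A := [set n | has_resolution_le C M n]%classic.
have resE : res_dim C M = infimum +oo%E [set n%:Z%:E | n in A]%classic by [].
have [[n An]|nA] := pselect (exists n, has_resolution_le C M n); last first.
  left; split=> [|n An]; last by apply: nA; exists n.
  rewrite resE; suff -> : A = set0 by rewrite image_set0 /infimum eqxx.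
  by apply/seteqP; split=> // n An; apply: nA; exists n.
have Ab : exists n, `[< A n >] by exists n; apply/asboolP.
case: (ex_minnP Ab) => m /asboolP Am min_m; right; exists m.
have le_m k : A k -> (m <= k)%N by move=> Ak; apply: min_m; apply/asboolP.
split=> //; rewrite resE /infimum ifF; last first.
  by apply/negbTE/set0P; exists m%:Z%:E, m.
apply: xget_subset1; last exact: is_subset1_infimums.
split=> [_ [k Ak <-]|b]; first by rewrite lee_fin lez_nat le_m.
by apply; exists m.
Qed.

Lemma res_dim_leP (n : nat) :
  (res_dim C M <= n%:Z%:E)%E <-> has_resolution_le C M n.
Proof.
case: res_dim_cases => [[-> noX]|[m [-> Xm le_m]]].
  by split=> // /noX.
rewrite lee_fin lez_nat; split=> [mn|/le_m//].
exact: has_resolution_le_mono Xm.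
Qed.

Lemma res_dim_ge0 : (0 <= res_dim C M)%E.
Proof.
by case: res_dim_cases => [[-> _]|[m [-> _ _]]]; rewrite ?leey// lee_fin.
Qed.

End ResDim.

Section SupProjDim.
Variables (S : pzRingType) (C : lmodType S -> Prop).

(** [supremum] would fall back to [-oo] if no least upper bound existed. Here every upper bound is a
    natural number or [+oo], so there is a least one. *)
Lemma supremums_ereal_int (A : set (\bar int)) :
  (A !=set0)%classic -> (forall x, A x -> (0 <= x)%E) ->
  (supremums A !=set0)%classic.
Proof.
move=> [a Aa] A0.
have ub_nat b : ubound A b -> b = +oo%E \/ exists n : nat, b = n%:Z%:E.
  move=> /(_ _ Aa) /(le_trans (A0 _ Aa)); case: b => [[n|//]| |//] _;
    last by left.
  by right; exists n.
have [ubn|no_ub] := pselect (exists n : nat, ubound A n%:Z%:E); last first.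
  exists +oo%E; split=> [x _|b Ab]; first exact: leey.
  by have [->//|[n bn]] := ub_nat b Ab; case: no_ub; exists n; rewrite -bn.
have ubb : exists n : nat, `[< ubound A n%:Z%:E >].
  by case: ubn => n ubn; exists n; apply/asboolP.
case: (ex_minnP ubb) => m /asboolP ubm min_m.
exists m%:Z%:E; split=> // b Ab.
have [->|[n bn]] := ub_nat b Ab; first exact: leey.
by rewrite bn lee_fin lez_nat; apply: min_m; apply/asboolP; rewrite -bn.
Qed.

Lemma le_sup_proj_dim M : C M -> (proj_dim M <= sup_proj_dim C)%E.
Proof.
move=> CM; apply: ge_supremum_Nmem; last by exists M.
apply: supremums_ereal_int; first by exists (proj_dim M), M.
by move=> _ [N _ ->]; exact: res_dim_ge0.
Qed.

Lemma sup_proj_dim_le M0 (b : \bar int) :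
  C M0 -> (forall M, C M -> (proj_dim M <= b)%E) -> (sup_proj_dim C <= b)%E.
Proof.
move=> CM0 pd_le; rewrite /sup_proj_dim /supremum.
set A := [set x | exists2 M, C M & x = proj_dim M]%classic.
have A_neq0 : (A !=set0)%classic by exists (proj_dim M0), M0.
case: ifPn => [/eqP A0|_]; first by have /set0P := A_neq0; rewrite A0 eqxx.
have [|s sA] := supremums_ereal_int A_neq0.
  by move=> _ [N _ ->]; exact: res_dim_ge0.
rewrite (xget_subset1 _ sA (@is_subset1_supremums _ _ _)).
by apply: (proj2 sA) => _ [M CM ->]; exact: pd_le.
Qed.

End SupProjDim.

(** * Splicing, vanishing of Tor, and the two inequalities *)

Lemma exact_pair_inj (S : pzRingType) (A B C D : lmodType S)
    (f : {linear A -> B}) (g : {linear B -> C}) (i : {linear C -> D}) :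
  injective i -> exact_pair f g -> exact_pair f (i \o g).
Proof.
move=> i_inj fg b; rewrite -fg /=; split=> [igb|->]; last by rewrite raddf0.
by apply: i_inj; rewrite igb raddf0.
Qed.

Lemma splice_resolution (S : pzRingType) (C : lmodType S -> Prop)
    (K P M : lmodType S) (i : {linear K -> P}) (g : {linear P -> M}) (n : nat) :
  injective i -> exact_pair i g -> surj g -> C P ->
  has_resolution_le C K n -> has_resolution_le C M n.+1.
Proof.
move=> i_inj ig gsurj CP [X [CX Xn]].
(* [X] is shifted up by one degree, [P] fills degree 0, and the junction is the augmentation of [X]
   followed by [i]. *)
pose obj k : lmodType S := if k is k'.+1 then X k' else P.
pose d k : {linear obj k.+1 -> obj k} :=
  if k is k'.+1 return {linear obj k.+1 -> obj k} then res_d X k'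
  else i \o res_aug X.
have d_exact k : exact_pair (d k.+1) (d k).
  case: k => [|k]; last exact: res_exact.
  exact: exact_pair_inj i_inj (@res_exact_aug _ _ X).
have d_exact_aug : exact_pair (d 0%N) g.
  move=> p; rewrite ig; split=> [[w <-]|[x <-]]; last by exists (res_aug X x).
  by have [x <-] := res_surj X w; exists x.
exists (Resolution d_exact d_exact_aug gsurj); split; first by case.
by case=> [//|k] nk; exact: Xn.
Qed.

(* Tor_1(H, K) = Tor_2(H, P / K) vanishes when H has a flat resolution        *)
(* 0 -> F1 -> F0 -> H -> 0.  The chase below runs through the double complex  *)
(* of the F_i (x) X, extended by F_i (x) P on the right.                      *)
Lemma submodule_free_F1_flat (R : pzRingType) (T : eqType) (K P : lmodType R)
    (e : T -> P) (c : T -> {linear P -> R^o}) (i : {linear K -> P}) :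
  basis_coord e c -> injective i -> F1_flat K.
Proof.
move=> Pec i_inj H /(res_dim_leP (@flat R) H 1)[Y [flatY Y1]] X _.
pose j := res_d Y 0; pose p := res_aug Y.
have j_inj : injective j.
  move=> u v juv; apply/eqP; rewrite -subr_eq0; apply/eqP.
  have /res_exact[w <-] : j (u - v) = 0 by rewrite linearB juv subrr.
  (* [Y] has length at most 1, so its term in degree 2 is zero and [j] has no kernel. *)
  by rewrite (Y1 2%N _ w)// raddf0.
have [j0 j0E] := exists_tensor_mapl (X 0%N) j.
have [j1 j1E] := exists_tensor_mapl (X 1%N) j.
have [jP jPE] := exists_tensor_mapl P j.
have [p0 p0E] := exists_tensor_mapl (X 0%N) p.
have [p1 p1E] := exists_tensor_mapl (X 1%N) p.
have [p2 p2E] := exists_tensor_mapl (X 2%N) p.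
pose aug : {linear X 0%N -> P} := i \o res_aug X.
have aug_exact : exact_pair (res_d X 0) aug.
  exact: exact_pair_inj i_inj (@res_exact_aug _ _ X).
have psurj := res_surj Y.
move=> z; split=> [dz|[y <-]]; last first.
  rewrite tensor_map_comp; apply: tensor_map0 => x /=.
  by apply/res_exact; exists x.
have [z0 z0E] := tensor_mapl_surj p1E psurj z.
(* The boundary of the lift [z0] dies over [H] because [z] is a cycle, so it comes from [Y 1]. *)
have [w1 w1E] : exists w1, j0 w1 = tensor_map (Y 0%N) (res_d X 0) z0.
  apply: (tensor_mapl_exact j0E p0E psurj (@res_exact_aug _ _ Y)).
  by rewrite -(tensor_map_mapl (res_d X 0) p1E p0E) z0E.
(* Freeness of [P] enters here: the image of [w1] may be tested over [Y 0], where it is a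
   differential followed by [aug]. *)
have augw1 : tensor_map (Y 1%N) aug w1 = 0.
  apply: (basis_tensor_inj Pec jPE j_inj).
  rewrite -(tensor_map_mapl aug j0E jPE) w1E tensor_map_comp.
  by apply: tensor_map0 => x; apply/aug_exact; exists x.
have [w2 w2E] := proj1 (flat_exact (flatY 1%N) aug_exact w1) augw1.
(* Correcting [z0] by [j1 w2] makes it a cycle over the flat module [Y 0]; the correction disappears
   over [H] since [p] kills the image of [j]. *)
have [y0 y0E] : exists y0, tensor_map (Y 0%N) (res_d X 1) y0 = z0 - j1 w2.
  apply/(flat_exact (flatY 0%N) (@res_exact _ _ X 0)).
  by rewrite raddfB /= (tensor_map_mapl (res_d X 0) j1E j0E) w2E w1E subrr.
exists (p2 y0); rewrite (tensor_map_mapl (res_d X 1) p2E p1E) y0E raddfB z0E.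
suff -> : p1 (j1 w2) = 0 by rewrite subr0.
elim/tensor_ind: {w2E y0E} w2 => [|x y px py|f x]; first by rewrite !raddf0.
  by rewrite !raddfB /= px py subrr.
rewrite j1E p1E; suff -> : p (j f) = 0 by rewrite tens0l.
by apply/res_exact_aug; exists f.
Qed.

Theorem corollary4p8 (R : pzRingType) :
  (sup_proj_dim (@F1_flat R) <= l_gl_dim R)%E /\
  (l_gl_dim R <= 1 + sup_proj_dim (@F1_flat R))%E.
Proof.
have cover (M : lmodType R) : exists (K P : lmodType R)
    (i : {linear K -> P}) (g : {linear P -> M}),
    [/\ projective P, F1_flat K, injective i, exact_pair i g & surj g].
  (* The free module on the underlying set of [M]; the identity of [M] extends to the cover [g]. *)
  have [P [e [c Pec]]] := exists_basis R M.
  have [g gE] := basis_lift Pec id.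
  have [|K [i [i_inj iP]]] := @exists_submodule R P (fun x => g x = 0).
    by split=> [|a u v gu gv]; rewrite ?raddf0// linearP gu gv scaler0 addr0.
  exists K, P, i, g; split=> //; first exact: basis_projective Pec.
    exact: submodule_free_F1_flat Pec i_inj.
  by move=> m; exists (e m).
(* Some F1-flat module, witnessing that both suprema range over nonempty sets. *)
have [K0 [_ [_ [_ [_ K0F1 _ _ _]]]]] := cover (R^o : lmodType R).
split.
  by apply: (sup_proj_dim_le K0F1) => M _; exact: le_sup_proj_dim.
apply: (@sup_proj_dim_le R (fun=> True) K0) => // M _.
have [K [P [i [g [Pproj KF1 i_inj ig gsurj]]]]] := cover M.
have := le_sup_proj_dim KF1; have := res_dim_ge0 (@projective R) K.
(* The supremum dominates [proj_dim K], which is nonnegative; this excludes negative integers and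
   [-oo], while [+oo] bounds everything. *)
rewrite -/(proj_dim K); case: (sup_proj_dim _) => [[n|n]| |] pd0 pdK.
- have /res_dim_leP/(splice_resolution i_inj ig gsurj Pproj) := pdK.
  by move/res_dim_leP; rewrite -EFinD -PoszD.
- by have := le_trans pd0 pdK.
- by rewrite addey// leey.
- by have := le_trans pd0 pdK.
Qed.
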